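(* Let $s\ge1$ be an integer, let $\mu_1,\ldots,\mu_s$ be probability measures on $\mathbb{R}$, let $\rho:\mathcal{P}(\mathbb{R})\to\mathbb{R}$ be a law-invariant risk measure, and let $\pi=(\pi_1,\ldots,\pi_s)\in\Sigma_s$ with $\pi_j>0$ for all $j$. Assume that the function $\Sigma_s\ni(p_1,\ldots,p_s)\mapsto\rho\left(\sum_{j=1}^sp_j\mu_j\right)$ is continuous. For $r\in\mathbb{R}$ let $$H_{\rho,\langle\pi,\mu\rangle}(r):=\inf\left\{\sum_{j=1}^sp_j\log\frac{p_j}{\pi_j}:(p_1,\ldots,p_s)\in\Sigma_s,\ \rho\left(\sum_{j=1}^sp_j\mu_j\right)=r\right\}.$$ Assume that there exist strictly decreasing functions $\Psi_\rho(\mu_1,\cdot),\ldots,\Psi_\rho(\mu_s,\cdot):\mathbb{R}\to\mathbb{R}$ such that, for all $r\in\mathbb{R}$, $$H_{\rho,\langle\pi,\mu\rangle}(r)=\inf\left\{\sum_{j=1}^sp_j\log\frac{p_j}{\pi_j}:(p_1,\ldots,p_s)\in\Sigma_s,\ \sum_{j=1}^sp_j\Psi_\rho(\mu_j,r)=0\right\},$$ and such that for every $i\in\{1,\ldots,s\}$ there exists a unique $r_i^{(0)}\in\mathbb{R}$ with $\Psi_\rho(\mu_i,r_i^{(0)})=0$. Set $\underline{r}_\rho:=\min\{r_i^{(0)}:i\in\{1,\ldots,s\}\}$ and $\overline{r}_\rho:=\max\{r_i^{(0)}:i\in\{1,\ldots,s\}\}$. (i) If $\underline{r}_\rho=\overline{r}_\rho$,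 then $$H_{\rho,\langle\pi,\mu\rangle}(r)=\begin{cases}0&\text{if } r=r_1^{(0)}=\cdots=r_s^{(0)}\\ \infty&\text{otherwise.}\end{cases}$$ (ii) If $\underline{r}_\rho<\overline{r}_\rho$, then $$H_{\rho,\langle\pi,\mu\rangle}(r)=\begin{cases}-\log\left(\sum_{j=1}^s\pi_je^{-\lambda_*(r)\Psi_\rho(\mu_j,r)}\right)&\text{if } r\in(\underline{r}_\rho,\overline{r}_\rho)\\ -\log\sum_{j:r_j^{(0)}=\overline{r}_\rho}\pi_j&\text{if } r=\overline{r}_\rho\\ -\log\sum_{j:r_j^{(0)}=\underline{r}_\rho}\pi_j&\text{if } r=\underline{r}_\rho\\ \infty&\text{if } r\notin[\underline{r}_\rho,\overline{r}_\rho],\end{cases}$$ where, for $r\in(\underline{r}_\rho,\overline{r}_\rho)$, $\lambda_*(r)\in\mathbb{R}$ is such that $$\frac{\sum_{j=1}^s\pi_j\Psi_\rho(\mu_j,r)e^{-\lambda_*(r)\Psi_\rho(\mu_j,r)}}{\sum_{j=1}^s\pi_je^{-\lambda_*(r)\Psi_\rho(\mu_j,r)}}=0.$$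
   Context: $\mathcal{P}(\mathbb{R})$ is the set of probability measures on the real line; a law-invariant risk measure is any map $\rho:\mathcal{P}(\mathbb{R})\to\mathbb{R}$. The simplex is $\Sigma_s:=\{(p_1,\ldots,p_s):p_1,\ldots,p_s\geq 0,\ p_1+\cdots+p_s=1\}$. Conventions: $p_j\log\frac{p_j}{\pi_j}=0$ if $p_j=0$; $\inf\emptyset=\infty$. The notation $\Psi_\rho(\mu_i,\cdot)$ just denotes a real function attached to the index $i$. *)

(* Defs.v *)
From HB Require Import structures.
From mathcomp Require Import all_boot all_order all_algebra.
From mathcomp Require Import all_classical all_reals all_analysis.

Set Implicit Arguments.
Unset Strict Implicit.
Unset Printing Implicit Defensive.

Import Order.TTheory GRing.Theory Num.Theory.
Import numFieldNormedType.Exports.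

Local Open Scope classical_set_scope.
Local Open Scope ring_scope.

(* Used below as a type (via [set_type]), with the subspace topology inherited
   from ['rV[R]_s]. *)
Definition simplex (R : realType) (s : nat) : set 'rV[R]_s :=
  [set p | (forall j, 0 <= p 0 j) /\ \sum_j p 0 j = 1].
Arguments simplex : clear implicits.

Definition weight (R : realType) (s : nat) (p : simplex R s) (j : 'I_s) : R :=
  (set_val p : 'rV[R]_s) 0 j.

Section mixture.
Local Open Scope ereal_scope.
Context d (T : measurableType d) (R : realType) (s : nat).
Variables (mu : 'I_s -> probability T R) (p : simplex R s).

Definition mixture (A : set T) : \bar R := \sum_j (weight p j)%:E * mu j A.

Lemma weight_ge0 j : (0 <= weight p j)%R.
Proof. by rewrite /weight; have [] := set_valP p. Qed.

Lemma sum_weight : (\sum_j weight p j = 1)%R.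
Proof. by rewrite /weight; have [] := set_valP p. Qed.

Let mixture0 : mixture set0 = 0.
Proof. by rewrite /mixture big1// => j _; rewrite measure0 mule0. Qed.

Let mixture_ge0 A : 0 <= mixture A.
Proof.
by apply: sume_ge0 => j _; rewrite mule_ge0// lee_fin weight_ge0.
Qed.

Let mixture_sigma_additive : semi_sigma_additive mixture.
Proof.
move=> F mF tF mUF; rewrite [X in X @ \oo --> _](_ : _ = (fun n =>
    \sum_j (weight p j)%:E * \sum_(0 <= i < n) mu j (F i))); last first.
  apply/funext => n; rewrite exchange_big/=.
  by apply: eq_bigr => j _; rewrite ge0_sume_distrr.
apply: cvg_nnesum => j _.
  by apply: nearW => n; rewrite mule_ge0 ?lee_fin ?weight_ge0// sume_ge0.
by apply: cvgeZl => //; exact: measure_semi_sigma_additive.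
Qed.

HB.instance Definition _ := isMeasure.Build _ _ _ mixture
  mixture0 mixture_ge0 mixture_sigma_additive.

Let mixture_setT : mixture setT = 1.
Proof.
rewrite /mixture; under eq_bigr do rewrite probability_setT mule1.
by rewrite sumEFin sum_weight.
Qed.

HB.instance Definition _ :=
  Measure_isProbability.Build _ _ _ mixture mixture_setT.

End mixture.

(* A [probability] is a function on all subsets, so two terms of that type may
   differ on non-measurable sets while being the same Borel probability
   measure; a map on the set of Borel probability measures has to identify
   them. *)
Definition law_invariant (R : realType)
    (rho : probability (measurableTypeR R) R -> R) : Prop :=
  forall P Q : probability (measurableTypeR R) R,
    (forall A, measurable A -> P A = Q A) -> rho P = rho Q.

(* The convention that a term is 0 when [weight p j = 0] holds since the first
   factor vanishes. *)
Definition relative_entropy (R : realType) (s : nat) (p q : simplex R s) : R :=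
  \sum_j weight p j * ln (weight p j / weight q j).

(* [ereal_inf set0 = +oo]. *)
Definition rate (R : realType) (s : nat)
    (rho : probability (measurableTypeR R) R -> R) (pi : simplex R s)
    (mu : 'I_s -> probability (measurableTypeR R) R) (r : R) : \bar R :=
  ereal_inf [set (relative_entropy p pi)%:E
            | p in [set p : simplex R s | rho (mixture mu p) = r]].

(* Main.v *)
(* For a tilting [c >= 0] of [pi] put [W = sum_j pi_j c_j].  Nonnegativity of the
   entropy relative to [pi_j c_j / W] gives
   [sum_j p_j ln (p_j / pi_j) >= sum_j p_j ln c_j - ln W], with equality for the
   tilted weights themselves.  On the constraint set [sum_j p_j Psi_j r = 0] the
   first term of the bound vanishes both for the exponential tilting
   [c_j = exp (- lambda Psi_j r)] (interior [r]) and for the indicator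
   [c_j = (Psi_j r == 0)] (endpoints, where all [Psi_j r] have the same sign, so
   that the constraint forces [p] to live on the zero set).  Outside of
   [[rmin, rmax]] all [Psi_j r] are nonzero of the same sign and no [p] is
   admissible. *)
Require Import Defs.
From mathcomp Require Import all_boot all_order all_algebra.
From mathcomp Require Import all_classical all_reals all_analysis.
From mathcomp Require Import ring lra.

Set Implicit Arguments.
Unset Strict Implicit.
Unset Printing Implicit Defensive.

Import Order.TTheory GRing.Theory Num.Theory.
Import numFieldNormedType.Exports.

Local Open Scope classical_set_scope.
Local Open Scope ring_scope.

(** * Entropy bounds from tilted weights *)

Definition tilt_mass (R : realType) (s : nat) (pi : simplex R s)
  (c : 'I_s -> R) : R := \sum_j weight pi j * c j.

Section tilting.
Context (R : realType) (s : nat) (pi : simplex R s).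
Hypothesis pi_gt0 : forall j, 0 < weight pi j.

(* [ln x <= x - 1] at [x = w_j / (p_j W)], with [w_j = pi_j c_j], [W = sum w]. *)
Lemma relative_entropy_ge (c : 'I_s -> R) (p : simplex R s) :
  (forall j, 0 <= c j) -> 0 < tilt_mass pi c ->
  (forall j, c j = 0 -> weight p j = 0) ->
  \sum_j weight p j * ln (c j) - ln (tilt_mass pi c) <= relative_entropy p pi.
Proof.
move=> c_ge0 W_gt0 supp; set W := tilt_mass pi c in W_gt0 *.
have -> : ln W = \sum_j weight p j * ln W by rewrite -mulr_suml sum_weight mul1r.
rewrite -sumrB -subr_ge0 /relative_entropy -sumrB.
(* Both vectors have total mass 1; writing 0 as the sum of their differences reduces the bound to a
   termwise one. *)
have W0 : 0 = \sum_j (weight p j - weight pi j * c j / W) :> R.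
  by rewrite sumrB sum_weight -mulr_suml divff ?gt_eqF// subrr.
rewrite [leLHS]W0; apply: ler_sum => j _.
have := weight_ge0 p j; rewrite le_eqVlt => /predU1P[<-|p_gt0].
  by rewrite !mul0r !subr0 sub0r oppr_le0 divr_ge0 ?(ltW W_gt0)// mulr_ge0// ltW.
have c_gt0 : 0 < c j.
  by rewrite lt0r c_ge0 andbT; apply/eqP => /supp p0; rewrite p0 ltxx in p_gt0.
have x_gt0 : 0 < weight pi j * c j / (weight p j * W).
  by rewrite divr_gt0 ?mulr_gt0.
have := le_ln1Dx (x := weight pi j * c j / (weight p j * W) - 1).
rewrite [1 + _]addrC subrK ltrBrDr addNr => /(_ x_gt0).
rewrite !ln_div ?posrE ?mulr_gt0// !lnM ?posrE// => lnx.
rewrite -!mulrBr.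
have -> : weight p j - weight pi j * c j / W =
    weight p j * (1 - weight pi j * c j / (weight p j * W)).
  by field; rewrite !gt_eqF.
by rewrite ler_pM2l//; lra.
Qed.

Lemma tilt_subproof (c : 'I_s -> R) :
  (forall j, 0 <= c j) -> 0 < tilt_mass pi c ->
  (\row_j (weight pi j * c j / tilt_mass pi c) : 'rV[R]_s) \in simplex R s.
Proof.
move=> c_ge0 W_gt0; apply/mem_set; split=> [j|].
  by rewrite mxE divr_ge0 ?(ltW W_gt0)// mulr_ge0// ltW.
under eq_bigr do rewrite mxE.
by rewrite -mulr_suml divff ?gt_eqF.
Qed.

Lemma exists_tilt (c : 'I_s -> R) :
  (forall j, 0 <= c j) -> 0 < tilt_mass pi c ->
  exists p : simplex R s,
    forall j, weight p j = weight pi j * c j / tilt_mass pi c.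
Proof.
move=> c_ge0 W_gt0.
exists (exist (fun q => q \in simplex R s) _ (tilt_subproof c_ge0 W_gt0)) => j.
by rewrite /weight/= mxE.
Qed.

(** Equality case of the bound: [weight p j / weight pi j] is now [c j / tilt_mass pi c], so its
    logarithm splits. *)
Lemma relative_entropy_tilt (c : 'I_s -> R) (p : simplex R s) :
  (forall j, 0 <= c j) -> 0 < tilt_mass pi c ->
  (forall j, weight p j = weight pi j * c j / tilt_mass pi c) ->
  relative_entropy p pi =
  \sum_j weight p j * ln (c j) - ln (tilt_mass pi c).
Proof.
move=> c_ge0 W_gt0 pE; set W := tilt_mass pi c in W_gt0 pE *.
have -> : ln W = \sum_j weight p j * ln W by rewrite -mulr_suml sum_weight mul1r.
rewrite -sumrB; apply: eq_bigr => j _; rewrite -mulrBr.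
have := c_ge0 j; rewrite le_eqVlt => /predU1P[c0|c_gt0].
  by rewrite pE -c0 mulr0 !mul0r.
congr (_ * _); rewrite -ln_div ?posrE//; congr ln.
by rewrite pE; field; rewrite !gt_eqF.
Qed.

(* Where [c j = 0] the junk value [ln 0 = 0] is harmless: there [p_j = 0]. *)
Lemma ereal_inf_relative_entropy (A : set (simplex R s)) (c : 'I_s -> R) :
  (forall j, 0 <= c j) -> 0 < tilt_mass pi c ->
  (forall p, A p -> forall j, c j = 0 -> weight p j = 0) ->
  (forall p, A p -> \sum_j weight p j * ln (c j) = 0) ->
  (forall p, (forall j, weight p j = weight pi j * c j / tilt_mass pi c) ->
    A p) ->
  ereal_inf [set (relative_entropy p pi)%:E | p in A] =
  (- ln (tilt_mass pi c))%:E.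
Proof.
move=> c_ge0 W_gt0 supp ln0 Atilt; apply/eqP; rewrite eq_le; apply/andP; split.
  have [p pE] := exists_tilt c_ge0 W_gt0.
  apply: ereal_inf_lbound; exists p; first exact: Atilt.
  by rewrite (relative_entropy_tilt c_ge0 W_gt0 pE) ln0 ?sub0r//; exact: Atilt.
apply: le_ereal_inf_tmp => _ [p Ap <-]; rewrite lee_fin.
have := relative_entropy_ge c_ge0 W_gt0 (supp p Ap).
by rewrite ln0// sub0r.
Qed.

Lemma psumr_gt0 (c : 'I_s -> R) j :
  (forall i, 0 <= c i) -> 0 < c j -> 0 < \sum_i c i.
Proof.
move=> c_ge0 cj; rewrite (bigD1 j)//= ltr_pwDl//.
exact: sumr_ge0.
Qed.

(** * The entropy infimum under one linear constraint *)

Definition constrained_inf (a : 'I_s -> R) : \bar R :=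
  ereal_inf [set (relative_entropy p pi)%:E
            | p in [set p : simplex R s | \sum_j weight p j * a j = 0]].

(** Transfers the results for nonnegative [a] to nonpositive [a], the situation for [r >= rmax]. *)
Lemma constrained_infN (a : 'I_s -> R) :
  constrained_inf (fun j => - a j) = constrained_inf a.
Proof.
have sumN (p : simplex R s) :
    \sum_j weight p j * - a j = - \sum_j weight p j * a j.
  by rewrite -sumrN; apply: eq_bigr => j _; rewrite mulrN.
rewrite /constrained_inf; congr (ereal_inf (_ @` _)).
apply/seteqP; split => p /=; rewrite sumN.
  by move=> /eqP; rewrite oppr_eq0 => /eqP.
by move=> ->; rewrite oppr0.
Qed.

Lemma constrained_inf_pos (a : 'I_s -> R) :
  (forall j, 0 < a j) -> constrained_inf a = +oo%E.
Proof.
move=> a_gt0; rewrite /constrained_inf (_ : [set p | _] = set0).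
  by rewrite image_set0 ereal_inf0.
apply/seteqP; split => // p /= pa0.
have /psumr_eq0P pz : forall j, true -> 0 <= weight p j * a j.
  by move=> j _; rewrite mulr_ge0 ?weight_ge0// ltW.
have := sum_weight p; rewrite big1 => [/eqP|j _]; first by rewrite eq_sym oner_eq0.
by have /eqP := pz pa0 j isT; rewrite mulf_eq0 (gt_eqF (a_gt0 j)) orbF => /eqP.
Qed.

(** The minimiser is [pi] conditioned on the zero set of [a]; the index [j0] keeps the mass of that
    set positive. *)
Lemma constrained_inf_nonneg (a : 'I_s -> R) j0 :
  (forall j, 0 <= a j) -> a j0 = 0 ->
  constrained_inf a = (- ln (\sum_(j | a j == 0) weight pi j))%:E.
Proof.
move=> a_ge0 aj0; pose c j : R := (a j == 0)%:R.
have c_ge0 j : 0 <= c j by rewrite ler0n.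
have -> : \sum_(j | a j == 0) weight pi j = tilt_mass pi c.
  by rewrite big_mkcond; apply: eq_bigr => j _; rewrite /c mulr_natr mulrb.
rewrite /constrained_inf; apply: ereal_inf_relative_entropy => //.
- apply: (@psumr_gt0 _ j0) => [i|]; first by rewrite mulr_ge0// ltW.
  by rewrite /c aj0 eqxx mulr1.
- move=> p /= pa0 j /eqP; rewrite pnatr_eq0 eqb0 => aj.
  have /psumr_eq0P pz : forall j, true -> 0 <= weight p j * a j.
    by move=> i _; rewrite mulr_ge0 ?weight_ge0.
  by have /eqP := pz pa0 j isT; rewrite mulf_eq0 (negbTE aj) orbF => /eqP.
(* [c j] is 1 or 0, and [ln] vanishes at both, at 0 by its default value. *)
- move=> p _; rewrite big1// => j _; rewrite /c.
  by case: (a j == 0); rewrite ?ln1 ?ln0 ?mulr0.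
- move=> p pE /=; rewrite big1// => j _; rewrite pE /c.
  by case: eqP => [->|_]; rewrite !(mulr0, mul0r).
Qed.

(** On the constraint set the mean of [ln (c j)] is [- l] times the mean of [a], hence 0; the
    gradient equation says that the tilted weights themselves satisfy the constraint. *)
Lemma constrained_inf_tilt (a : 'I_s -> R) (l : R) :
  0 < \sum_j weight pi j * expR (- l * a j) ->
  \sum_j weight pi j * a j * expR (- l * a j) = 0 ->
  constrained_inf a = (- ln (\sum_j weight pi j * expR (- l * a j)))%:E.
Proof.
move=> W_gt0 grad0; pose c j := expR (- l * a j).
rewrite /constrained_inf; apply: (@ereal_inf_relative_entropy _ c) => //.
- by move=> j; exact: expR_ge0.
- by move=> p _ j /eqP; rewrite /c gt_eqF// expR_gt0.
- move=> p /= pa0; under eq_bigr do rewrite expRK mulrCA.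
  by rewrite -mulr_sumr pa0 mulr0.
- move=> p pE /=.
  transitivity ((\sum_j weight pi j * a j * c j) / tilt_mass pi c); last first.
    by rewrite grad0 mul0r.
  by rewrite mulr_suml; apply: eq_bigr => j _; rewrite pE /c; ring.
Qed.

(* [x e^(t x) >= x] for all [x], and [>= x + t x^2] for [x > 0]: the latter term
   at [j0] dominates for large [t]. *)
Lemma exists_gradient_ge0 (a : 'I_s -> R) j0 : 0 < a j0 ->
  exists2 t, 0 <= t & 0 <= \sum_j weight pi j * a j * expR (t * a j).
Proof.
move=> aj0; set S := \sum_j weight pi j * a j.
have d_gt0 : 0 < weight pi j0 * a j0 ^+ 2 by rewrite mulr_gt0 ?exprn_gt0.
(* Chosen so that the quadratic gain at [j0] is exactly [|S|], and [S + |S| >= 0]. *)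
pose t := `|S| / (weight pi j0 * a j0 ^+ 2).
have t_ge0 : 0 <= t by rewrite divr_ge0// ltW.
exists t => //.
have Sle : S + `|S| <= \sum_j weight pi j * a j * expR (t * a j).
  have -> : `|S| = t * (weight pi j0 * a j0 ^+ 2) by rewrite divfK ?gt_eqF.
  rewrite /S (bigD1 j0)//= [leRHS](bigD1 j0)//= addrAC lerD//.
    have -> : weight pi j0 * a j0 + t * (weight pi j0 * a j0 ^+ 2) =
      weight pi j0 * a j0 * (1 + t * a j0) by ring.
    by rewrite ler_pM2l ?mulr_gt0// expR_ge1Dx.
  apply: ler_sum => j _; rewrite -[leRHS]mulrA ler_pM2l//.
  have [a_ge0|a_lt0] := leP 0 (a j).
    by rewrite ler_peMr// -expR0 ler_expR mulr_ge0.
  by rewrite ler_niMr ?(ltW a_lt0)// -expR0 ler_expR mulr_ge0_le0// ltW.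
by apply: le_trans Sle; rewrite -lerBlDr sub0r lerNl ler_normr lexx orbT.
Qed.

(** Intermediate value theorem: the previous lemma for [a] gives a nonnegative value at some
    [- t <= 0], and for [- a] a nonpositive value at some [u >= 0]. *)
Lemma exists_critical_tilt (a : 'I_s -> R) j0 j1 : 0 < a j0 -> a j1 < 0 ->
  exists l, \sum_j weight pi j * a j * expR (- l * a j) = 0.
Proof.
move=> a0 a1; pose F l := \sum_j weight pi j * a j * expR (- l * a j).
have [t t_ge0 Ft] := exists_gradient_ge0 a0.
have [u u_ge0 Fu] := @exists_gradient_ge0 (fun j => - a j) j1
  (etrans (oppr_gt0 _) a1).
have exp_cont j : continuous (fun l : R => expR (- l * a j)).
  move=> x; apply: continuous_comp.
    by apply: cvgM; [exact: opp_continuous|exact: cvg_cst].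
  exact: continuous_expR.
have F_cont : continuous F.
  apply: continuous_big => [|j _ x]; first exact: add_continuous.
  by apply: cvgM; [exact: cvg_cst|exact: exp_cont].
have Fnt : 0 <= F (- t) by rewrite /F opprK.
have Fpu : F u <= 0.
  rewrite -oppr_ge0 /F -sumrN (le_trans Fu)// le_eqVlt; apply/orP; left.
  by apply/eqP/eq_bigr => j _; rewrite !mulrN !mulNr.
have [|||l _ Fl] := @IVT R F (- t) u 0.
- by rewrite (le_trans _ u_ge0)// oppr_le0.
- exact: continuous_subspaceT.
- by rewrite ge_min le_max Fnt Fpu orbT.
- by exists l.
Qed.

End tilting.

Theorem theorem3p1 (R : realType) (s : nat) (hs : (0 < s)%N)
  (mu : 'I_s -> probability (measurableTypeR R) R)
  (rho : probability (measurableTypeR R) R -> R)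
  (hrho : law_invariant rho)
  (pi : simplex R s) (hpi : forall j, 0 < weight pi j)
  (hcont : continuous (fun p : simplex R s => rho (mixture mu p)))
  (Psi : 'I_s -> R -> R)
  (hPsi_decr : forall j, {homo Psi j : x y /~ x < y})
  (hPsi_rate : forall r : R,
    rate rho pi mu r =
    ereal_inf [set (relative_entropy p pi)%:E
              | p in [set p : simplex R s |
                      \sum_j weight p j * Psi j r = 0]])
  (r0 : 'I_s -> R)
  (hr0 : forall i, unique (fun r => Psi i r = 0) (r0 i)) :
  let rmin := \big[Num.min/r0 (Ordinal hs)]_(i < s) r0 i in
  let rmax := \big[Num.max/r0 (Ordinal hs)]_(i < s) r0 i in
  let Z (lambda r : R) :=
    \sum_j weight pi j * expR (- lambda * Psi j r) in
  (rmin = rmax ->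
    forall r : R,
      rate rho pi mu r = if [forall i, r == r0 i] then 0%E else +oo%E)
  /\
  (rmin < rmax ->
    [/\ forall r : R, rmin < r < rmax ->
          let is_lambda_star (lambda : R) :=
            (\sum_j weight pi j * Psi j r * expR (- lambda * Psi j r))
              / Z lambda r = 0 in
          (exists lambda : R, is_lambda_star lambda) /\
          (forall lambda : R, is_lambda_star lambda ->
            rate rho pi mu r = (- ln (Z lambda r))%:E),
        rate rho pi mu rmax =
          (- ln (\sum_(j | r0 j == rmax) weight pi j))%:E,
        rate rho pi mu rmin =
          (- ln (\sum_(j | r0 j == rmin) weight pi j))%:E
      & forall r : R, ~~ (rmin <= r <= rmax) -> rate rho pi mu r = +oo%E]).
Proof.
move=> rmin rmax Z.
have Psi_root i r : (Psi i r == 0) = (r0 i == r).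
  have [Psi0 uniq_root] := hr0 i.
  by apply/eqP/eqP => [/uniq_root|<-].
(* Strict decrease through the root [r0 i] fixes the sign of [Psi i r] on either side of it. *)
have Psi_lt0 i r : r0 i < r -> Psi i r < 0.
  by move=> /(hPsi_decr i); rewrite (proj1 (hr0 i)).
have Psi_gt0 i r : r < r0 i -> 0 < Psi i r.
  by move=> /(hPsi_decr i); rewrite (proj1 (hr0 i)).
have rateE r : rate rho pi mu r = constrained_inf pi (Psi ^~ r).
  exact: hPsi_rate.
have rmin_le i : rmin <= r0 i by exact: bigmin_le_cond.
have rmax_ge i : r0 i <= rmax by exact: le_bigmax_cond.
have [imin rminE] : exists i, r0 i = rmin.
  apply: (big_ind (fun x => exists i, r0 i = x)); first by exists (Ordinal hs).
  - by move=> x y [i <-] [j <-]; case: (leP (r0 i) (r0 j)) => _; [exists i|exists j].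
  - by move=> i _; exists i.
have [imax rmaxE] : exists i, r0 i = rmax.
  apply: (big_ind (fun x => exists i, r0 i = x)); first by exists (Ordinal hs).
  - by move=> x y [i <-] [j <-]; case: (leP (r0 i) (r0 j)) => _; [exists j|exists i].
  - by move=> i _; exists i.
(* At [rmin] every [Psi j] is nonnegative and vanishes exactly where [r0 j] attains the minimum; at
   [rmax] the signs are reversed. *)
have rate_rmin : rate rho pi mu rmin =
    (- ln (\sum_(j | r0 j == rmin) weight pi j))%:E.
  rewrite rateE (@constrained_inf_nonneg _ _ _ _ _ imin)//.
  - by under eq_bigl do rewrite Psi_root.
  - move=> j; have := rmin_le j; rewrite le_eqVlt => /predU1P[->|/Psi_gt0/ltW//].
    by rewrite (proj1 (hr0 j)).
  - by apply/eqP; rewrite Psi_root rminE.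
have rate_rmax : rate rho pi mu rmax =
    (- ln (\sum_(j | r0 j == rmax) weight pi j))%:E.
  rewrite rateE -constrained_infN (@constrained_inf_nonneg _ _ _ _ _ imax)//.
  - by under eq_bigl do rewrite oppr_eq0 Psi_root.
  - move=> j; rewrite oppr_ge0.
    have := rmax_ge j; rewrite le_eqVlt => /predU1P[<-|/Psi_lt0/ltW//].
    by rewrite (proj1 (hr0 j)).
  - by apply/eqP; rewrite oppr_eq0 Psi_root rmaxE.
have rate_out r : ~~ (rmin <= r <= rmax) -> rate rho pi mu r = +oo%E.
  rewrite negb_and -!ltNge rateE => /orP[r_lt|r_gt].
    by apply: constrained_inf_pos => j; apply: Psi_gt0; exact: lt_le_trans (rmin_le j).
  rewrite -constrained_infN; apply: constrained_inf_pos => j.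
  by rewrite oppr_gt0; apply: Psi_lt0; exact: le_lt_trans (rmax_ge j) _.
split=> [rmm r|rmm].
  have r0E i : r0 i = rmin.
    by apply/eqP; rewrite eq_le rmin_le rmm rmax_ge.
  case: ifPn => [/forallP/(_ imin)/eqP ->|].
    (* All roots coincide, so the endpoint sum runs over all indices and equals 1. *)
    rewrite r0E rate_rmin; under eq_bigl do rewrite r0E eqxx.
    by rewrite sum_weight ln1 oppr0.
  move=> /forallPn[i]; rewrite r0E => r_neq.
  by apply: rate_out; rewrite -rmm -eq_le eq_sym.
split=> // r /andP[r_gt r_lt] is_lambda_star.
have Z_gt0 l : 0 < Z l r.
  apply: (@psumr_gt0 _ _ _ imin) => [i|]; last by rewrite mulr_gt0 ?expR_gt0.
  by rewrite mulr_ge0 ?expR_ge0// ltW.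
split=> [|l /eqP].
  (* Strictly between the extreme roots, [Psi imax r] is positive and [Psi imin r] negative. *)
  have [||l Hl] := @exists_critical_tilt _ _ _ hpi (Psi ^~ r) imax imin.
  - by apply: Psi_gt0; rewrite rmaxE.
  - by apply: Psi_lt0; rewrite rminE.
  - by exists l; rewrite /is_lambda_star Hl mul0r.
(* As [Z l r] is positive, the quotient vanishes only if its numerator does. *)
rewrite mulf_eq0 invr_eq0 (gt_eqF (Z_gt0 l)) orbF => /eqP grad0.
rewrite rateE.
exact: (@constrained_inf_tilt _ _ _ hpi (Psi ^~ r) l (Z_gt0 l) grad0).
Qed.
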